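(* Let $(M,d)$ be a complete metric space and $X\subseteq M$ compact. Assume that every $\mu\in P(X)$ admits a barycenter in $M$, and that the barycentric convex hull $Y=conv(X)$ is compact. Then there exists a circumcenter $\nu\in P(M)$ of $i(X)$ in $(P(M),W_2)$, and the square $R^2$ of the circumradius $R$ of $i(X)$ equals both $\max_{\mu\in P(X)}Var(\mu)$ and $\min_{\bar\nu\in P(Y)}AVar(\bar\nu)$. Furthermore, any $\bar\mu\in P(X)$ maximizing the variance satisfies $W_2(\delta_x,\nu)=R$ for $\bar\mu$-almost every $x$, and if $\bar\nu$ is any other circumcenter of $i(X)$, then also $W_2(\delta_x,\bar\nu)=R$ for $\bar\mu$-almost every $x$.
   Context: $P(\cdot)$ denotes Borel probability measures. For $\mu\in P(X)$, $Var(\mu)=\inf_{y\in M}\int_X d^2(x,y)\,d\mu(x)$, and a barycenter of $\mu$ is a point $y\in M$ attaining this infimum. $conv(X)$ is the set of all barycenters in $M$ of measures $\mu\in P(X)$. For $\bar\nu\in P(Y)$, $AVar(\bar\nu)=\max_{x\in X}\int_Y d^2(x,y)\,d\bar\nu(y)$. $W_2$ is the Wasserstein distance on $P(M)$: $W_2^2(\mu,\nu)=\inf_\gamma\int_{M\times M}d^2(x,y)\,d\gamma(x,y)$ over couplings $\gamma$ of $\mu,\nu$; in particular $W_2^2(\delta_x,\nu)=\int_M d^2(x,y)\,d\nu(y)$. The map $i:X\to P(M)$ is $i(x)=\delta_x$. The circumradius of $i(X)$ is $\inf_{\nu\in P(M)}\sup_{x\in X}W_2(\delta_x,\nu)$,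 and a circumcenter of $i(X)$ is a $\nu\in P(M)$ with $\sup_{x\in X}W_2(\delta_x,\nu)$ equal to this circumradius. *)

(* Defs.v *)
From HB Require Import structures.
From mathcomp Require Import all_boot all_order all_algebra.
From mathcomp Require Import all_classical all_reals all_analysis.
Set Implicit Arguments. Unset Strict Implicit. Unset Printing Implicit Defensive.
Import Order.TTheory GRing.Theory Num.Theory.
Local Open Scope classical_set_scope.
Local Open Scope ring_scope.

(* Metric spaces with a distinguished point (needed by the library's
   measurable-type hierarchy; harmless since X is assumed nonempty). *)
#[short(type="pmetricType")]
HB.structure Definition PointedMetric (K : numDomainType) :=
  { M of Metric K M & isPointed M }.

Definition borel (R : realType) (M : pmetricType R) := g_sigma_algebraType (@open M).

Section defs.
Context {R : realType} {M : pmetricType R}.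
Local Notation d := (@mdist R M).
Local Notation PM := (probability (borel M) R).

Definition complete_metric : Prop :=
  forall F : set_system M, ProperFilter F -> cauchy F -> exists l : M, F --> l.

(* P(X), X a (closed) subset of M: Borel probability measures on M
   concentrated on X. *)
Definition PX (X : set M) : set PM := [set mu : PM | mu X = 1%E].

Definition second_moment (mu : PM) (y : M) : \bar R :=
  (\int[mu]_x ((d x y) ^+ 2)%:E)%E.

Definition Var (mu : PM) : \bar R :=
  ereal_inf [set second_moment mu y | y in [set: M]].

Definition is_barycenter (mu : PM) (y : M) : Prop :=
  second_moment mu y = Var mu.

Definition bconv (X : set M) : set M :=
  [set y | exists2 mu, PX X mu & is_barycenter mu y].

Definition AVar (X : set M) (nu : PM) : \bar R :=
  ereal_sup [set (\int[nu]_y ((d x y) ^+ 2)%:E)%E | x in X].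

(* W_2(delta_x, nu), via W_2^2(delta_x,nu) = \int d^2(x,y) dnu(y) *)
Definition W2_dirac (x : M) (nu : PM) : \bar R :=
  sqrte (\int[nu]_y ((d x y) ^+ 2)%:E)%E.

Definition farthest (X : set M) (nu : PM) : \bar R :=
  ereal_sup [set W2_dirac x nu | x in X].

Definition circumradius (X : set M) : \bar R :=
  ereal_inf [set farthest X nu | nu in [set: PM]].

Definition is_circumcenter (X : set M) (nu : PM) : Prop :=
  farthest X nu = circumradius X.
End defs.

(* Main.v *)
(* Write c(x,y) = d(x,y)^2. The theorem is a minimax statement for the game in
   which one player chooses mu in P(X), the other y, with payoff
   int c(x,y) dmu(x).

   P(K) is sequentially compact for compact K: K is coded by binary sequences,
   an ultrafilter limit of the masses of the cylinders is consistent, hence it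
   is the law of the bits of a point of [0,1[ for the Lebesgue measure, and the
   limit measure is the image of the latter by the decoding map. This gives a
   maximizer mu0 of the variance, with value v.

   For the second player, Blackwell's approachability strategy is used: against
   the points of a finite net of X, always answer with a barycenter of the
   measure whose weights are the positive parts of the current excesses over v;
   since the variance of that measure is at most v, the average excesses
   are eventually at most any given eps > 0. The empirical measures of the answers, and compactness again,
   give nu0 in P(Y) with int c(x,y) dnu0(y) <= v on X. Fubini gives
   Var mu <= int int c dnu dmu for all mu in P(X) and nu in P(M), hence the
   equality of the three values, and the equality almost everywhere for
   maximizers of the variance. *)
Require Import Defs.
From HB Require Import structures.
From mathcomp Require Import all_boot all_order all_algebra.
From mathcomp Require Import all_classical all_reals all_analysis.
From mathcomp Require Import measurable_realfun lra.
Import Order.TTheory GRing.Theory Num.Theory.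
Import numFieldNormedType.Exports.
Local Open Scope classical_set_scope.
Local Open Scope ring_scope.
Local Open Scope ereal_scope.

(** * Continuity and Borel measurability of the distance *)

Lemma continuous_lipschitz {R : realType} {M : pmetricType R} (f : M -> R) (k : R) :
  (forall x y, `|f x - f y| <= k * mdist x y)%R -> continuous f.
Proof.
move=> fk x; apply/cvgrPdist_lt => e e0.
have k1 : (0 < `|k| + 1)%R by rewrite ltr_wpDl.
have de : (0 < e / (`|k| + 1))%R by rewrite divr_gt0.
apply: filterS (nbhsx_ballx x _ de) => y; rewrite ballEmdist/= ltr_pdivlMr// => xy.
apply: le_lt_trans (fk _ _) _; apply: le_lt_trans xy.
rewrite mulrC; apply: ler_wpM2l; first exact: mdist_ge0.
by rewrite (le_trans (ler_norm _))// lerDl.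
Qed.

Lemma ler_mdist_dist {R : realType} {M : pmetricType R} (x x' y : M) :
  (`|mdist x y - mdist x' y| <= mdist x x')%R.
Proof.
rewrite ler_norml lerBlDr metric_triangle andbT.
rewrite lerNl opprB lerBlDr metric_sym [X in (_ <= X + _)%R]metric_sym.
by rewrite [leLHS]metric_sym metric_triangle.
Qed.

Lemma mdist_continuous {R : realType} {M : pmetricType R} (y : M) :
  continuous (fun x : M => mdist x y).
Proof.
apply: (@continuous_lipschitz _ _ _ 1) => x x'.
by rewrite mul1r ler_mdist_dist.
Qed.

Lemma sqr_mdist_continuous {R : realType} {M : pmetricType R} (y : M) :
  continuous (fun x : M => (mdist x y ^+ 2)%R).
Proof.
move=> x; apply: (@continuousM _ _ (fun x => mdist x y) (fun x => mdist x y));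
  exact: mdist_continuous.
Qed.

Lemma open_measurable_borel {R : realType} {M : pmetricType R} (U : set M) :
  open U -> measurable (U : set (borel M)).
Proof. exact: sub_sigma_algebra. Qed.

Lemma closed_measurable_borel {R : realType} {M : pmetricType R} (F : set M) :
  closed F -> measurable (F : set (borel M)).
Proof.
move=> cF; rewrite -(setCK F); apply: measurableC; apply: open_measurable_borel.
exact: closed_openC.
Qed.

Lemma compact_measurable_borel {R : realType} {M : pmetricType R} (K : set M) :
  compact K -> measurable (K : set (borel M)).
Proof.
move=> cK; apply: closed_measurable_borel; apply: compact_closed cK.
exact: metric_hausdorff.
Qed.

Lemma continuous_measurable_borel {R : realType} {M : pmetricType R} (f : M -> R) :
  continuous f -> measurable_fun [set: borel M] (f : borel M -> R).
Proof.
move=> /continuousP cf; apply: (measurability _ (RGenOpens.measurableE R)).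
move=> _ [_ [a [b ->] <-]]; rewrite setTI.
by apply: open_measurable_borel; exact/cf/interval_open.
Qed.

Lemma ball_open_mdist {R : realType} {M : pmetricType R} (x : M) (e : R) :
  open [set y | (mdist y x < e)%R].
Proof.
rewrite (_ : [set y | _] = (fun y => mdist y x) @^-1` [set r | (r < e)%R])//.
by move/continuousP : (@mdist_continuous _ _ x); apply; exact: open_lt.
Qed.

(** * Countable nets, cylinders and random bits *)

(** A single sequence serves all scales: it lists, over pairs [(k, j)], the [j]-th center of a
    finite cover of [K] by balls of radius [1/(k+1)]. The finite bound [N] lets later arguments
    handle finitely many centers at a time. *)
Lemma compact_net {R : realType} {M : pmetricType R} (K : set M) :
  compact K -> K !=set0 ->
  exists2 q : nat -> M, (forall n, K (q n)) &
    forall e : R, (0 < e)%R -> exists N, forall x, K x ->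
      exists2 i, (i < N)%N & (mdist x (q i) < e)%R.
Proof.
move=> cK [x0 Kx0].
have fin (k : nat) : exists s : seq M, (forall x, x \in s -> K x) /\
    forall x, K x -> exists2 z, z \in s & (mdist x z < k.+1%:R^-1)%R.
  move: (cK); rewrite compact_cover.
  move=> /(_ M K (fun z => [set x | (mdist x z < k.+1%:R^-1)%R])) [].
  - by move=> z _; exact: ball_open_mdist.
  - by move=> x Kx; exists x => //=; rewrite mdistxx invr_gt0.
  - move=> D DK KD; exists (finmap.enum_fset D); split.
      by move=> x /(DK x); rewrite inE.
    by move=> x /KD[z /= zD xz]; exists z.
have [s sP] := choice fin.
(* Indices that code no pair and positions beyond the end of [s k] default to [x0], which keeps the
   whole sequence in [K]. *)
pose q n := if @unpickle (nat * nat)%type n is Some (k, j) then nth x0 (s k) j else x0.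
exists q.
  move=> n; rewrite /q; case: unpickle => // -[k j].
  have [js|js] := ltnP j (size (s k)); last by rewrite nth_default.
  by apply: (sP k).1; exact: mem_nth.
move=> e e0; pose k := Num.truncn e^-1.
have ke : (k.+1%:R^-1 < e)%R.
  by rewrite invf_plt ?posrE//; exact: truncnS_gt.
exists (\max_(j < size (s k)) pickle (k, nat_of_ord j)).+1 => x /(sP k).2[z zs xz].
have js : (index z (s k) < size (s k))%N by rewrite index_mem.
exists (pickle (k, index z (s k))).
  by rewrite ltnS (leq_bigmax (Ordinal js)).
by rewrite /q pickleK nth_index// (lt_trans xz).
Qed.

(* The last bit comes first, so that extending a prefix is a [cons]. *)
Fixpoint revprefix (b : nat -> bool) (k : nat) : seq bool :=
  if k is k'.+1 then b k' :: revprefix b k' else [::].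

Lemma size_revprefix b k : size (revprefix b k) = k.
Proof. by elim: k => //= k ->. Qed.

Lemma eq_revprefix (b b' : nat -> bool) (m k : nat) : (m <= k)%N ->
  revprefix b k = revprefix b' k -> revprefix b m = revprefix b' m.
Proof.
elim: k => [|k IH]; first by rewrite leqn0 => /eqP ->.
by rewrite leq_eqVlt => /predU1P[->//|mk] /= [_]; exact: IH.
Qed.

Lemma revprefixP (b b' : nat -> bool) (m : nat) :
  revprefix b m = revprefix b' m -> forall i, (i < m)%N -> b i = b' i.
Proof.
elim: m => //= m IH [bm /IH {}IH] i.
by rewrite ltnS leq_eqVlt => /predU1P[->//|]; exact: IH.
Qed.

Definition cylinder {T : Type} (b : T -> nat -> bool) (r : seq bool) : set T :=
  [set t | revprefix (b t) (size r) = r].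

Lemma cylinder_revprefix {T : Type} (b : T -> nat -> bool) t k :
  cylinder b (revprefix (b t) k) t.
Proof. by rewrite /cylinder/= size_revprefix. Qed.

Lemma cylinder_cons {T : Type} (b : T -> nat -> bool) c r :
  cylinder b (c :: r) = cylinder b r `&` [set t | b t (size r) = c].
Proof.
by apply/seteqP; split => t /=; rewrite /cylinder/=; [case=> -> ->|case=> -> ->].
Qed.

Lemma cylinder_split {T : Type} (b : T -> nat -> bool) r :
  cylinder b r = cylinder b (false :: r) `|` cylinder b (true :: r).
Proof.
rewrite !cylinder_cons -setIUr; apply/esym/setIidPl => t _ /=.
by case: (b t (size r)); [right|left].
Qed.

Lemma cylinder_measurable {d} {T : measurableType d} (b : T -> nat -> bool) :
  (forall n, measurable [set t | b t n]) -> forall r, measurable (cylinder b r).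
Proof.
move=> mb; elim=> [|c r IH].
  by rewrite (_ : cylinder b _ = setT)//; apply/seteqP; split.
rewrite cylinder_cons; apply: measurableI => //; case: c; first exact: mb.
rewrite (_ : [set t | _] = ~` [set t | b t (size r)]); first exact: measurableC.
by apply/seteqP; split => t /=; [move=> ->|move/negP/negbTE].
Qed.

(* Bits of a uniform random number with prescribed conditional
   probabilities: [w t k] selects the half of the current interval
   [[a r, a r + p r[] containing [t]. *)
Lemma bit_process {R : realType} (p : seq bool -> R) :
  (forall r, 0 <= p r)%R -> p [::] = 1%R ->
  (forall r, p r = p (false :: r) + p (true :: r))%R ->
  exists (P : probability (measurableTypeR R) R) (b : measurableTypeR R -> nat -> bool),
    [/\ forall n, measurable [set t | b t n],
        forall r, P (cylinder b r) = (p r)%:E &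
        forall t k, (0 < p (revprefix (b t) k))%R].
Proof.
move=> p0 p1 pD.
(* The [false] child keeps the left end of its parent's interval; the [true] child starts where the
   [false] one stops. *)
pose a := fix a (r : seq bool) : R :=
  if r is c :: r' then (a r' + if c then p (false :: r') else 0)%R else 0%R.
pose w (t : R) := fix w k : seq bool :=
  if k is k'.+1 then (a (w k') + p (false :: w k') <= t)%R :: w k' else [::].
pose b0 (t : measurableTypeR R) k := (a (w t k) + p (false :: w t k) <= t)%R.
have wE t k : revprefix (b0 t) k = w t k by elim: k => //= k ->.
have arange r : (0 <= a r)%R /\ (a r + p r <= 1)%R.
  elim: r => [|c r [IH1 IH2]] /=; first by rewrite p1 add0r.
  have := p0 (c :: r); have := p0 (~~ c :: r); have := pD r.
  by case: c => /=; lra.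
have cylE r t : (0 <= t < 1)%R ->
    cylinder b0 r t <-> (a r <= t < a r + p r)%R.
  move=> t01; elim: r => [|c r IH]; first by rewrite /cylinder/= p1 add0r t01.
  rewrite cylinder_cons /=; split.
    move=> [rt <-]; have /IH /andP[art tar] := rt.
    have wr : w t (size r) = r by rewrite -wE.
    rewrite /b0 wr; have pDr := pD r.
    have [h|h] := leP (a r + p (false :: r))%R (t : R); first by apply/andP; split; lra.
    by rewrite addr0; apply/andP; split; lra.
  move=> h.
  have rt : cylinder b0 r t.
    apply/IH; move: h; have := pD r; have := p0 (~~ c :: r); have := p0 (c :: r).
    by case: (c) => /=; lra.
  split=> //; rewrite /b0 -wE rt; move: h; case: (c) => /= h; first by lra.
  by apply/negbTE; rewrite -ltNge; lra.
(* Points outside [[0,1[], which are null for [P], receive the bits of 0; thus the prefixes have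
   positive [p] for every [t], not just almost every [t]. *)
pose h (t : measurableTypeR R) : measurableTypeR R := if (0 <= t < 1)%R then t else 0%R.
have h01 t : (0 <= h t < 1)%R.
  by rewrite /h; case: ifPn => //; rewrite lexx ltr01.
have mh : measurable_fun setT h.
  apply: measurable_fun_ifT => //=.
  by apply: measurable_and; [exact: measurable_fun_ler|exact: measurable_fun_ltr].
pose m := mrestr (@lebesgue_measure R) (measurable_itv `[0%R, 1%R[).
have m1 : m setT = 1.
  rewrite /m /mrestr setTI lebesgue_measure_itv/= lte_fin ltr01.
  by rewrite sube0.
pose mP := Measure_isProbability.Build _ _ _ m m1.
pose P : probability (measurableTypeR R) R := HB.pack m mP.
have mb0 n : measurable [set t | b0 t n].
  have mle x : measurable [set t : measurableTypeR R | (x <= t)%R].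
    rewrite (_ : [set t | _] = `[x, +oo[%classic)//.
    by apply/seteqP; split=> y /=; rewrite in_itv/= andbT.
  have mw k : forall r, measurable [set t : measurableTypeR R | w t k = r].
    elim: k => [|k IH] [|c r] /=.
    - by rewrite (_ : [set t | _] = setT)//; apply/seteqP; split.
    - by rewrite (_ : [set t | _] = set0)//; apply/seteqP; split.
    - by rewrite (_ : [set t | _] = set0)//; apply/seteqP; split.
    - rewrite (_ : [set t | _] = [set t | w t k = r] `&`
          [set t | (a r + p (false :: r) <= t)%R = c]); last first.
        by apply/seteqP; split=> t /=; [case=> <- ->|case=> -> ->].
      apply: measurableI; first exact: IH.
      case: c; first exact: mle.
      rewrite (_ : [set t | _] = ~` [set t | (a r + p (false :: r) <= t)%R]).
        by apply: measurableC; exact: mle.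
      by apply/seteqP; split=> t /=; [move=> ->|move/negP/negbTE].
  (* The threshold deciding bit [n] depends on the earlier bits, so the event is cut along the
     countably many possible words. *)
  rewrite (_ : [set t | _] = \bigcup_(r : seq bool) ([set t | w t n = r] `&`
      [set t | (a r + p (false :: r) <= t)%R])); last first.
    by apply/seteqP; split=> t /=; [exists (w t n)|case=> r _ /= [<-]].
  apply: countable_bigcupT_measurable => // r.
  by apply: measurableI; [exact: mw|exact: mle].
exists P, (fun t => b0 (h t)); split.
- move=> n; rewrite -[X in measurable X]setTI; exact: (mh measurableT _ (mb0 n)).
- move=> r; have [ar0 ar1] := arange r.
  rewrite (_ : P _ = lebesgue_measure (cylinder (fun t => b0 (h t)) r `&` `[0%R, 1%R[))//.
  rewrite (_ : _ `&` _ = `[a r, (a r + p r)%R[%classic); last first.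
    apply/seteqP; split=> t /=; rewrite !in_itv/=.
      by move=> [+ t01]; rewrite /cylinder/= /h t01 => /cylE; exact.
    move=> H; have t01 : (0 <= t < 1)%R by lra.
    by split=> //; rewrite /cylinder/= /h t01; apply/cylE.
  rewrite lebesgue_measure_itv/= lte_fin ltrDl; case: ltP => pr.
    by rewrite -EFinD addrAC subrr add0r.
  by congr EFin; apply/eqP; rewrite eq_le p0 pr.
- move=> t k; have /(cylE _ _ (h01 t)) := cylinder_revprefix b0 (h t) k.
  lra.
Qed.

(** * Integrals against probability measures *)

Lemma probability_setC0 {d} {T : measurableType d} {R : realType}
    (P : probability T R) (E : set T) :
  measurable E -> P E = 1 -> P (~` E) = 0.
Proof. by move=> mE PE; rewrite probability_setC// PE subee. Qed.

Lemma probability_full {d} {T : measurableType d} {R : realType}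
    (P : probability T R) (E : set T) (Q : T -> Prop) :
  measurable E -> P E = 1 -> (forall t, E t -> Q t) -> {ae P, forall t, Q t}.
Proof.
move=> mE PE EQ; exists (~` E); split; first exact: measurableC.
  exact: probability_setC0.
by move=> t /= nQ Et; apply: nQ; exact: EQ.
Qed.

Lemma probability_integral_cst {d} {T : measurableType d} {R : realType}
    (P : probability T R) (r : \bar R) : \int[P]_t r = r.
Proof.
transitivity (r * P setT); first exact: integral_cst.
by rewrite probability_setT mule1.
Qed.

(** The comparison is needed on [E] only, since its complement is null, and total mass one makes a
    uniform error [e] cost at most [e]. *)
Lemma probability_integral_leD {d} {T : measurableType d} {R : realType}
    (P : probability T R) (E : set T) (f g : T -> R) (e : R) :
  measurable E -> P E = 1 -> measurable_fun setT f -> measurable_fun setT g ->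
  (forall t, 0 <= f t)%R -> (forall t, 0 <= g t)%R -> (0 <= e)%R ->
  (forall t, E t -> f t <= g t + e)%R ->
  \int[P]_t (f t)%:E <= \int[P]_t (g t)%:E + e%:E.
Proof.
move=> mE PE mf mg f0 g0 e0 fg.
have -> : \int[P]_t (g t)%:E + e%:E = \int[P]_t ((g t)%:E + e%:E).
  rewrite ge0_integralD//; last 2 first.
  - by move=> t _; rewrite lee_fin.
  - exact/measurable_EFinP.
  by congr (_ + _); exact/esym/probability_integral_cst.
apply: (@ae_ge0_le_integral _ _ _ P) => //.
- by move=> t _; rewrite lee_fin.
- exact/measurable_EFinP.
- by move=> t _; rewrite -EFinD lee_fin addr_ge0.
- by apply/measurable_EFinP; exact: measurable_funD.
by apply: probability_full mE PE _ => t Et _; rewrite -EFinD lee_fin fg.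
Qed.

(** Exactly one cylinder of length [m] contains a given point, so a function of the first [m] bits
    is a finite combination of indicators. Its integral sees only the cylinder masses, which is how
    convergence of masses becomes convergence of integrals. *)
Lemma integral_revprefix {d} {T : measurableType d} {R : realType}
    (P : probability T R) (b : T -> nat -> bool) (m : nat) (F : seq bool -> R) :
  (forall n, measurable [set t | b t n]) -> (forall r, 0 <= F r)%R ->
  measurable_fun setT (fun t => F (revprefix (b t) m)) /\
  \int[P]_t (F (revprefix (b t) m))%:E =
    (\sum_(r : m.-tuple bool) fine (P (cylinder b r)) * F r)%:E.
Proof.
move=> mb F0; have mc := cylinder_measurable _ mb.
have E t : (F (revprefix (b t) m) =
    \sum_(r : m.-tuple bool) F r * \1_(cylinder b r) t)%R.
  have sz : size (revprefix (b t) m) == m by rewrite size_revprefix.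
  rewrite (bigD1 (Tuple sz))//= indicE mem_set ?mulr1; last exact: cylinder_revprefix.
  rewrite big1 ?addr0// => r rt; rewrite indicE memNset ?mulr0//.
  rewrite /cylinder/= size_tuple => h; move/eqP : rt; apply.
  exact: val_inj.
have mi (r : seq bool) : measurable_fun setT (fun t => (F r * \1_(cylinder b r) t)%R).
  by apply: measurable_funM => //; exact: measurable_indic.
split.
  by under eq_fun do rewrite E; exact: measurable_sum.
under eq_integral do rewrite E -sumEFin.
rewrite ge0_integral_sum//; last 2 first.
- by move=> r; exact/measurable_EFinP.
- by move=> r t _; rewrite lee_fin mulr_ge0.
rewrite -sumEFin; apply: eq_bigr => r _.
under eq_integral do rewrite EFinM.
rewrite ge0_integralZl_EFin//; last exact/measurable_EFinP/measurable_indic.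
by rewrite integral_indic// setIT muleC EFinM fineK// fin_num_measure.
Qed.

(** * Sequential compactness of the probability measures on a compact set *)

(** Bit [(i, k)] tests membership in the ball of radius [1/(k+1)] around [q i]. Points of [K] that
    share enough bits lie in a common small ball. *)
Lemma compact_code {R : realType} {M : pmetricType R} (K : set M) :
  compact K -> K !=set0 ->
  exists2 b : borel M -> nat -> bool, (forall n, measurable [set x | b x n]) &
    forall e : R, (0 < e)%R -> exists m, forall x y : M, K x -> K y ->
      revprefix (b x) m = revprefix (b y) m -> (mdist x y < e)%R.
Proof.
move=> cK K0; have [q Kq qnet] := compact_net _ cK K0.
pose b (x : borel M) n := if @unpickle (nat * nat)%type n is Some (i, k)
  then (mdist (x : M) (q i) < k.+1%:R^-1)%R else false.
exists b.
  move=> n; rewrite /b; case: unpickle => [[i k]|].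
    exact: open_measurable_borel (ball_open_mdist _ _).
  by rewrite (_ : [set x | _] = set0)//; apply/seteqP; split.
move=> e e0; pose k := Num.truncn (e / 2)^-1.
have ke : (k.+1%:R^-1 < e / 2)%R.
  by rewrite invf_plt ?posrE ?divr_gt0//; exact: truncnS_gt.
have [|N qN] := qnet (k.+1%:R^-1)%R; first by rewrite invr_gt0.
(* A prefix of this length contains the bit [(i, k)] for every [i < N], hence the test of some ball
   containing [x]. *)
exists (\max_(i < N) pickle (nat_of_ord i, k)).+1 => x y Kx Ky /revprefixP xy.
have [i iN xi] := qN x Kx.
have := xy (pickle (i, k)); rewrite ltnS (leq_bigmax (Ordinal iN)) => /(_ isT).
rewrite /b pickleK xi => /esym yi.
apply: le_lt_trans (metric_triangle _ (q i) _) _.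
rewrite [X in (_ + X)%R]metric_sym; apply: lt_trans (ltrD xi yi) _.
by move: ke; move: (k.+1%:R^-1)%R => z; lra.
Qed.

(** Compactness of [[0,1]] gives a cluster point, and an ultrafilter converges to each of its
    cluster points. *)
Lemma ultrafilter_bounded_cvg {R : realType} (U : set_system nat) (u : nat -> R) :
  UltraFilter U -> (forall n, 0 <= u n <= 1)%R ->
  exists2 l : R, (0 <= l)%R & u @ U --> l.
Proof.
move=> UU u01.
have uU : (u @ U) `[0%R, 1%R]%classic.
  have : U (u @^-1` `[0%R, 1%R]%classic) by apply: filterE => n /=; rewrite in_itv/=.
  by [].
have [l [/= l01 lc]] := @segment_compact R 0%R 1%R (u @ U) _ uU.
exists l; first by move: l01; rewrite in_itv/= => /andP[].
move=> A lA; have [//|UA] := in_ultra_setVsetC (u @^-1` A) UU.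
by have [x []] := lc (~` A) A UA lA.
Qed.

(** The index [n] may depend on [f]: no common subsequence is asserted, and the semicontinuity
    arguments below test one function at a time. The Lipschitz bound on [K] turns agreement of codes
    into closeness of values. *)
Lemma compact_PX {R : realType} {M : pmetricType R} (K : set M)
    (mu_ : nat -> probability (borel M) R) :
  compact K -> K !=set0 -> (forall n, PX K (mu_ n)) ->
  exists2 mu : probability (borel M) R, PX K mu &
    forall (f : M -> R) (L : R), continuous f -> (forall x, 0 <= f x)%R ->
      (forall x y, K x -> K y -> `|f x - f y| <= L * mdist x y)%R ->
      forall (e : R) (N : nat), (0 < e)%R -> exists2 n, (N <= n)%N &
        \int[mu]_x (f x)%:E <= \int[mu_ n]_x (f x)%:E + e%:E /\
        \int[mu_ n]_x (f x)%:E <= \int[mu]_x (f x)%:E + e%:E.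
Proof.
move=> cK K0 muK.
have mK := compact_measurable_borel _ cK.
have [b mb sep] := compact_code _ cK K0.
have mcyl := cylinder_measurable _ mb.
have [U [UU ooU]] := @ultraFilterLemma _ (\oo : set_system nat) _.
pose pn n r := fine (mu_ n (cylinder b r)).
have pnE n r : mu_ n (cylinder b r) = (pn n r)%:E.
  by rewrite /pn fineK// fin_num_measure.
have pn01 r n : (0 <= pn n r <= 1)%R.
  by rewrite -!lee_fin -pnE measure_ge0 probability_le1.
have /choice[p pP] : forall r, exists l : R, (0 <= l)%R /\ pn ^~ r @ U --> l.
  by move=> r; have [l l0 lU] := ultrafilter_bounded_cvg U _ UU (pn01 r); exists l.
have p0 r : (0 <= p r)%R by have [] := pP r.
have pU r : pn ^~ r @ U --> p r by have [] := pP r.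
(* Uniqueness of limits along [U] transfers to [p] what holds for the masses of every [mu_ n]: total
   mass one, additivity, vanishing. *)
have puniq (u : nat -> R) (l l' : R) : u @ U --> l -> u @ U --> l' -> l = l'.
  by move=> ul ul'; rewrite -(cvg_lim (@Rhausdorff R) ul) (cvg_lim (@Rhausdorff R) ul').
have p1 : p [::] = 1%R.
  apply: puniq (pU [::]) _; rewrite (_ : pn ^~ [::] = cst 1%R); first exact: cvg_cst.
  apply/funext => n; rewrite /pn (_ : cylinder b [::] = setT) ?probability_setT//.
  by apply/seteqP; split.
have pD r : (p r = p (false :: r) + p (true :: r))%R.
  apply: puniq (pU r) _.
  rewrite (_ : pn ^~ r = (fun n => pn n (false :: r) + pn n (true :: r))%R).
    exact: cvgD.
  apply/funext => n; apply: EFin_inj; rewrite EFinD -!pnE cylinder_split measureU//.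
  by rewrite !cylinder_cons; apply/seteqP; split => // x [] [_ /= ->] [].
have [P [B [mB PB pB]]] := bit_process _ p0 p1 pD.
have mcylB := cylinder_measurable _ mB.
(* A cylinder missing [K] is null for every [mu_ n], so its limit mass is zero. *)
have cellK r : (0 < p r)%R -> exists2 x, K x & cylinder b r x.
  move=> pr; apply: contrapT => nx.
  suff pr0 : p r = 0%R by rewrite pr0 ltxx in pr.
  apply: puniq (pU r) _; rewrite (_ : pn ^~ r = cst 0%R); first exact: cvg_cst.
  apply/funext => n; rewrite /pn; suff -> : mu_ n (cylinder b r) = 0 by [].
  apply: (@subset_measure0 _ _ _ (mu_ n) _ (~` K)) => //; first exact: measurableC.
    by move=> x bx Kx; apply: nx; exists x.
  exact: probability_setC0 (muK n).
have [x0 Kx0] := K0.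
(* [rep r] is a point of [K] in the cylinder of [r] whenever there is one, and [x0] otherwise. *)
have /choice[rep repP] : forall r, exists x, K x /\
    ((exists2 y, K y & cylinder b r y) -> cylinder b r x).
  move=> r; have [[y Ky ry]|ny] := pselect (exists2 y, K y & cylinder b r y).
    by exists y.
  by exists x0.
have repK r : K (rep r) by have [] := repP r.
have rep_cyl r y : K y -> cylinder b r y -> cylinder b r (rep r).
  by move=> Ky ry; have [_] := repP r; apply; exists y.
have rep_pre m y : K y -> revprefix (b (rep (revprefix (b y) m))) m = revprefix (b y) m.
  move=> Ky; have := rep_cyl _ _ Ky (cylinder_revprefix b y m).
  by rewrite /cylinder/= size_revprefix.
have rep_preB m t : revprefix (b (rep (revprefix (B t) m))) m = revprefix (B t) m.
  have [y Ky yB] := cellK _ (pB t m); have := rep_cyl _ _ Ky yB.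
  by rewrite /cylinder/= size_revprefix.
(* [g t] is the point of [K] whose code is [B t]. *)
have /choice[g gP] : forall t, exists l, K l /\ forall (e : R) m,
    (forall x y : M, K x -> K y ->
      revprefix (b x) m = revprefix (b y) m -> (mdist x y < e)%R) ->
    forall x, K x -> revprefix (b x) m = revprefix (B t) m -> (mdist x l <= e)%R.
  move=> t; pose u k := rep (revprefix (B t) k).
  have [l [Kl lc]] : K `&` cluster (u @ \oo) !=set0.
    by apply: cK; exists 0%N => // k _; exact: repK.
  exists l; split=> // e m em x Kx xB; apply/ler_addgt0Pr => eta eta0.
  (* From rank [m] on, the representatives share [m] bits with [x], so they stay within [e] of it,
     and so does their cluster point [l]. *)
  have /lc/(_ (nbhsx_ballx l _ eta0)) : (u @ \oo) [set y | (mdist x y < e)%R].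
    exists m => // k /= mk; apply: em => //; first exact: repK.
    by rewrite xB; apply/esym/(eq_revprefix _ _ _ _ mk); exact: rep_preB.
  move=> [y [/= xy]]; rewrite ballEmdist/= => ly.
  apply: le_trans (metric_triangle _ y _) _; apply: ltW; rewrite ltrD//.
  by rewrite metric_sym.
have gK t : K (g t) by have [] := gP t.
have gd t e m : (forall x y : M, K x -> K y ->
      revprefix (b x) m = revprefix (b y) m -> (mdist x y < e)%R) ->
    (mdist (rep (revprefix (B t) m)) (g t) <= e)%R.
  by move=> em; have [_ gl] := gP t; exact: gl em _ (repK _) (rep_preB _ _).
have mg : measurable_fun [set: measurableTypeR R] (g : _ -> borel M).
  apply: (@measurability _ _ (measurableTypeR R) (borel M) setT g (@open M)) => //.
  move=> _ [V oV <-]; rewrite setTI.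
  (* Up to a small error, [g t] is determined by finitely many bits of [t]; the preimage of an open
     set is therefore a union of cylinders, and there are only countably many. *)
  rewrite (_ : _ @^-1` _ =
    \bigcup_(r in [set r | cylinder B r `<=` g @^-1` V]) cylinder B r).
    rewrite bigcup_mkcond; apply: countable_bigcupT_measurable => // r.
    by case: ifP => // _; exact: mcylB.
  apply/seteqP; split => [t Vt|t [r /= rV /rV]//].
  have [e /= e0 eV] : exists2 e : R, (0 < e)%R & ball (g t) e `<=` V.
    move: oV; rewrite openE => /(_ _ Vt); rewrite /interior -nbhs_ballE.
    by move=> -[e /= e0 eV]; exists e.
  have [m em] := sep (e / 3)%R (divr_gt0 e0 (ltr0Sn _ _)).
  exists (revprefix (B t) m) => /=; last exact: cylinder_revprefix.
  move=> s; rewrite /cylinder/= size_revprefix => st; apply: eV.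
  rewrite ballEmdist/=; apply: le_lt_trans (metric_triangle _ (rep (revprefix (B t) m)) _) _.
  have := gd t _ _ em; have := gd s _ _ em.
  rewrite st [X in _ -> _ -> (X + _ < _)%R]metric_sym.
  by lra.
pose gmix := isMeasurableFun.Build _ _ _ _ _ mg.
pose G : {mfun measurableTypeR R >-> borel M} := HB.pack g gmix.
pose mu : probability (borel M) R := distribution P G.
exists mu.
  rewrite /PX/= (_ : mu K = P (g @^-1` K))// (_ : _ @^-1` _ = setT) ?probability_setT//.
  by apply/seteqP; split=> // t _; exact: gK.
move=> f L cf f0 fL e N e0.
have mf := continuous_measurable_borel _ cf.
have e30 : (0 < e / 3)%R by rewrite divr_gt0.
have L10 : (0 < `|L| + 1)%R by rewrite ltr_wpDl.
have fK x y eta : (mdist x y <= eta / (`|L| + 1))%R -> K x -> K y -> (`|f x - f y| <= eta)%R.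
  move=> xy Kx Ky; apply: le_trans (fL _ _ Kx Ky) _.
  rewrite ler_pdivlMr// mulrC in xy; apply: le_trans xy.
  by rewrite ler_wpM2r ?mdist_ge0// (le_trans (ler_norm _))// lerDl.
(* At this scale [f] varies by at most [e / 3] between points of [K] with the same [m] bits; the
   added 1 keeps the denominator positive. *)
have [m em] := sep (e / 3 / (`|L| + 1))%R (divr_gt0 e30 L10).
pose F r := f (rep r).
have F0 r : (0 <= F r)%R by exact: f0.
have [mFB iFB] := integral_revprefix P B m F mB F0.
have muE : \int[mu]_x (f x)%:E = \int[P]_t (f (g t))%:E.
  by rewrite ge0_integral_distribution//; exact/measurable_EFinP.
have fg t : (`|f (g t) - F (revprefix (B t) m)| <= e / 3)%R.
  by apply: fK => //; rewrite metric_sym gd.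
have fr y : K y -> (`|f y - F (revprefix (b y) m)| <= e / 3)%R.
  by move=> Ky; apply: fK => //; apply/ltW/em => //; rewrite rep_pre.
pose S (q : seq bool -> R) := (\sum_(r : m.-tuple bool) q r * F r)%R.
have SU : (fun n => S (pn n)) @ U --> S p.
  apply: cvg_big => [|r _]; first exact: add_continuous.
  by apply: cvgM; [exact: pU|exact: cvg_cst].
(* [U] refines [\oo], so it contains every tail, and some [n] beyond [N] is also good for the finite
   sum [S]. *)
have [n Nn Sn] : exists2 n, (N <= n)%N & (`|S p - S (pn n)| < e / 3)%R.
  have UN : U [set n | (N <= n)%N] by apply: ooU; exists N.
  have /cvgrPdist_lt/(_ _ e30) US := SU.
  by have [n [] Nn nS] := filter_ex (filterI UN US); exists n.
exists n => //.
have [mFn iFn] := integral_revprefix (mu_ n) b m F mb F0.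
have iFB' : \int[P]_t (F (revprefix (B t) m))%:E = (S p)%:E.
  by rewrite iFB; congr EFin; apply: eq_bigr => r _; rewrite PB.
have iFn' : \int[mu_ n]_t (F (revprefix (b t) m))%:E = (S (pn n))%:E by rewrite iFn.
have mfg : measurable_fun setT (f \o g) by exact: measurableT_comp mf mg.
have PT : P setT = 1 by exact: probability_setT.
have e3 := ltW e30.
rewrite muE.
have h1 : \int[P]_t (f (g t))%:E <= (S p)%:E + (e / 3)%:E.
  rewrite -iFB'; apply: (probability_integral_leD P setT) => // t _.
  by have := fg t; rewrite ler_norml; lra.
have h2 : (S p)%:E <= \int[P]_t (f (g t))%:E + (e / 3)%:E.
  rewrite -iFB'; apply: (probability_integral_leD P setT) => // t _.
  by have := fg t; rewrite ler_norml; lra.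
have h3 : \int[mu_ n]_x (f x)%:E <= (S (pn n))%:E + (e / 3)%:E.
  rewrite -iFn'; apply: (probability_integral_leD (mu_ n) K) => // [|t Kt].
    exact: muK.
  by have := fr t Kt; rewrite ler_norml; lra.
have h4 : (S (pn n))%:E <= \int[mu_ n]_x (f x)%:E + (e / 3)%:E.
  rewrite -iFn'; apply: (probability_integral_leD (mu_ n) K) => // [|t Kt].
    exact: muK.
  by have := fr t Kt; rewrite ler_norml; lra.
have [Sn1 Sn2] : (S p - S (pn n) < e / 3 /\ S (pn n) - S p < e / 3)%R.
  by move: Sn; rewrite ltr_norml; lra.
(* Three errors of [e / 3] add up: discretizing [f] for one measure, passing between the finite
   sums, and discretizing [f] for the other measure. *)
have fin (a c : R) (I J : \bar R) : (a - c < e / 3)%R ->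
    I <= a%:E + (e / 3)%:E -> c%:E <= J + (e / 3)%:E -> I <= J + e%:E.
  move=> ac Ia cJ; apply: le_trans Ia _.
  apply: (@le_trans _ _ (c%:E + (2 * (e / 3))%:E)).
    by rewrite -!EFinD lee_fin; lra.
  apply: le_trans (leeD2r _ cJ) _; rewrite -addeA -EFinD leeD2l// lee_fin; lra.
by split; [exact: fin h1 h4|exact: fin h3 h2].
Qed.

(** * Blackwell approachability and finitely supported measures *)

(** The potential is the sum of the squared positive parts of the accumulated excesses. Answering
    against these positive parts makes its first-order variation nonpositive, so it grows by at most
    [n * B ^+ 2] per round, and each excess is of order the square root of the number of rounds. *)
Lemma approachability {R : realType} {T : Type} (Y : set T) n
    (c : nat -> T -> R) (B : R) :
  (forall i y, Y y -> `|c i y| <= B)%R ->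
  (forall w : nat -> R, (forall i, 0 <= w i)%R ->
    exists2 y, Y y & (\sum_(i < n) w i * c i y <= 0)%R) ->
  forall e : R, (0 < e)%R -> exists N (ys : nat -> T),
    [/\ (0 < N)%N, forall t, Y (ys t) &
      forall i, (i < n)%N -> (\sum_(t < N) c i (ys t) <= e * N%:R)%R].
Proof.
move=> cB resp e e0.
pose pos (S : nat -> R) i := Num.max 0%R (S i).
have pos0 S i : (0 <= pos S i)%R by rewrite /pos le_max lexx.
have [F YF cF] : exists2 F : (nat -> R) -> T, forall S, Y (F S) &
    forall S, (\sum_(i < n) pos S i * c i (F S) <= 0)%R.
  have /choice[F FP] : forall S, exists y, Y y /\ (\sum_(i < n) pos S i * c i y <= 0)%R.
    by move=> S; have [y] := resp (pos S) (pos0 S); exists y.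
  by exists F => S; have [] := FP S.
pose S := fix S t : nat -> R :=
  if t is t'.+1 then fun i => (S t' i + c i (F (S t')))%R else fun=> 0%R.
have SE t i : S t i = (\sum_(s < t) c i (F (S s)))%R.
  by elim: t => [|t IH]; rewrite ?big_ord0// big_ord_recr/= -IH.
pose K := (n%:R * B ^+ 2)%R.
have K0 : (0 <= K)%R by rewrite mulr_ge0 ?sqr_ge0.
have potential t : (\sum_(i < n) pos (S t) i ^+ 2 <= t%:R * K)%R.
  elim: t => [|t IH].
    by rewrite mul0r big1// => i _; rewrite /pos maxxx expr0n.
  (* As [S t i <= pos (S t) i], the new positive part is at most the absolute value of
     [pos (S t) i + c i (F (S t))], whose square is expanded here. The cross terms are controlled by
     [cF] after summation. *)
  have step i : (pos (S t.+1) i ^+ 2 <=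
      pos (S t) i ^+ 2 + 2 * (pos (S t) i * c i (F (S t))) + B ^+ 2)%R.
    have cb : (c i (F (S t)) ^+ 2 <= B ^+ 2)%R.
      have := cB i _ (YF (S t)); rewrite -(real_normK (num_real (c i (F (S t))))) => cB'.
      by rewrite lerXn2r// nnegrE (le_trans _ cB').
    rewrite {1}/pos/=; have := pos0 (S t) i; have : (S t i <= pos (S t) i)%R.
      by rewrite /pos le_max lexx orbT.
    move: (pos (S t) i) (S t i) (c i (F (S t))) cb => p s a aB sp p0.
    have : (0 <= (p + a) ^+ 2)%R by exact: sqr_ge0.
    case: (leP 0%R (s + a)%R) => sa pa.
      have : (0 <= (p - s) * (s + a))%R by rewrite mulr_ge0// subr_ge0.
      have : (0 <= (p - s) ^+ 2)%R by exact: sqr_ge0.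
      by move: aB; rewrite !expr2; nra.
    by move: aB pa; rewrite !expr2; nra.
  apply: le_trans (ler_sum _ (fun i _ => step (nat_of_ord i))) _.
  rewrite !big_split/= -mulr_sumr sumr_const card_ord.
  rewrite -[X in (_ + X <= _)%R]mulr_natl -/K -natr1 mulrDl mul1r.
  by have := cF (S t); move: IH; lra.
(* This makes [N * e ^+ 2] exceed [K], so that the potential bound [N * K] is at most
   [(e * N) ^+ 2]. *)
pose N := (Num.truncn (K / e ^+ 2)).+1.
exists N, (fun t => F (S t)); split=> // i ilt.
rewrite -SE; apply: le_trans (_ : (pos (S N) i <= _)%R).
  by rewrite /pos le_max lexx orbT.
rewrite -(@ler_pXn2r _ 2)// ?nnegrE ?mulr_ge0 ?(ltW e0)//.
apply: le_trans (_ : (N%:R * K <= _)%R).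
  apply: le_trans (potential N); rewrite (bigD1 (Ordinal ilt))//= lerDl.
  by apply: sumr_ge0 => j _; rewrite sqr_ge0.
have : (K / e ^+ 2 < N%:R)%R by exact: truncnS_gt.
rewrite ltr_pdivrMr ?exprn_gt0// exprMn expr2 => KN.
rewrite mulrC (expr2 N%:R) mulrA ler_wpM2r//.
by rewrite mulrC ltW.
Qed.

Lemma discrete_probability {R : realType} {d : measure_display}
    {T : measurableType d} (n : nat) (w : nat -> R) (x : nat -> T) :
  (forall i, 0 <= w i)%R -> (\sum_(i < n) w i = 1)%R ->
  exists P : probability T R, forall f : T -> \bar R,
    measurable_fun setT f -> (forall t, 0 <= f t) ->
    \int[P]_t f t = \sum_(i < n) (w i)%:E * f (x i).
Proof.
move=> w0 w1.
pose m_ (i : nat) : {measure set T -> \bar R} := mscale (NngNum (w0 i)) (\d_(x i)).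
pose m := msum m_ n.
have mT : m setT = 1.
  rewrite /m /msum/= -w1 -sumEFin; apply: eq_bigr => i _.
  by rewrite /m_/= /mscale/= diracT mule1.
pose mP := Measure_isProbability.Build _ _ _ m mT.
pose P : probability T R := HB.pack m mP.
exists P => f mf f0.
rewrite (_ : \int[P]_t f t = \int[m]_t f t)//.
rewrite /m ge0_integral_measure_sum//; apply: eq_bigr => i _.
rewrite ge0_integral_mscale//= integral_dirac//.
by rewrite diracT mul1e.
Qed.

(** * Fubini for the squared distance and weak duality *)

(* [d] itself need not be measurable on the product of the Borel
   sigma-algebras when [M] is not separable. *)
Lemma measurable_indic_mdist {R : realType} {M : pmetricType R} (X : set M) :
  compact X -> X !=set0 ->
  measurable_fun setT
    (fun z : borel M * borel M => \1_X (z.1 : M) * (mdist (z.1 : M) z.2))%R.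
Proof.
move=> cX X0; have [q Xq qnet] := compact_net _ cX X0.
have mX := compact_measurable_borel _ cX.
pose A (r : R) := [set z : borel M * borel M | X z.1 /\ (mdist (z.1 : M) z.2 < r)%R].
have mA r : measurable (A r).
  pose Bx (i : nat * nat) := [set x : borel M | (mdist (x : M) (q i.1) < i.2.+1%:R^-1)%R].
  pose By (i : nat * nat) := [set y : borel M | (mdist (y : M) (q i.1) < r - i.2.+1%:R^-1)%R].
  (* For [x] in [X], [mdist x y < r] holds exactly when some net point is very near [x] and
     correspondingly less than [r] away from [y]: a countable union of rectangles. *)
  rewrite (_ : A r = \bigcup_(i : nat * nat) ((X `&` Bx i) `*` By i)).
    apply: countable_bigcupT_measurable => // i.
    apply: measurableX; first (apply: measurableI => //);
      exact: open_measurable_borel (ball_open_mdist _ _).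
  apply/seteqP; split=> -[x y] /=; last first.
    move=> [[i k] _ [/= [Xx xq] yq]]; split => //.
    apply: le_lt_trans (metric_triangle _ (q i) _) _.
    rewrite [X in (_ + X)%R]metric_sym; move: xq yq; rewrite /Bx /By/=.
    by move: (k.+1%:R^-1)%R => e; lra.
  move=> [/= Xx xy]; pose k := Num.truncn ((r - mdist (x : M) y) / 2)^-1.
  have r2 : (0 < (r - mdist (x : M) y) / 2)%R by rewrite divr_gt0// subr_gt0.
  have ke : (k.+1%:R^-1 < (r - mdist (x : M) y) / 2)%R.
    by rewrite invf_plt ?posrE//; exact: truncnS_gt.
  have [|N qN] := qnet (k.+1%:R^-1)%R; first by rewrite invr_gt0.
  have [i _ xi] := qN x Xx.
  exists (i, k) => //; split => //=; rewrite /By/=.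
  apply: le_lt_trans (metric_triangle _ (x : M) _) _.
  rewrite [X in (X + _)%R]metric_sym; move: ke xi; move: (k.+1%:R^-1)%R => e.
  by lra.
apply: (measurability _ (RGenInftyO.measurableE R)) => _ [_ [r ->] <-].
(* Off [X] the function is 0, so those points belong to the sublevel set exactly when [0 < r]. *)
rewrite setTI (_ : _ @^-1` _ = A r `|` [set z | ~ X z.1 /\ (0 < r)%R]).
  apply: measurableU => //.
  have [r0|r0] := ltP 0%R r; last first.
    by rewrite (_ : [set z | _] = set0)//; apply/seteqP; split => // z [].
  rewrite (_ : [set z | _] = (~` X) `*` setT).
    by apply: measurableX => //; exact: measurableC.
  by apply/seteqP; split => [z []|z [? _]].
apply/seteqP; split=> -[x y] /=; rewrite in_itv/= indicE.
  have [xX|nX] := boolP (x \in X); rewrite ?mul1r ?mul0r => xy.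
    by left; split => //; exact: set_mem.
  by right; split => // /mem_set; exact/negP.
move=> [[/= Xx xy]|[nX r0]]; first by rewrite mem_set// mul1r.
by rewrite memNset// mul0r.
Qed.

Lemma measurable_sqr_mdist {R : realType} {M : pmetricType R} (y : M) :
  measurable_fun [set: borel M] (fun x : borel M => ((mdist (x : M) y ^+ 2)%R)%:E).
Proof.
by apply/measurable_EFinP; exact: continuous_measurable_borel (sqr_mdist_continuous y).
Qed.

(** The factor [\1_X] makes the integrand measurable on the product, so that Tonelli applies, and
    changes no integral against [mu], which is concentrated on [X]. *)
Lemma fubini_sqr_mdist {R : realType} {M : pmetricType R} (X : set M)
    (mu nu : probability (borel M) R) :
  compact X -> X !=set0 -> PX X mu ->
  let H := fun x : borel M => \int[nu]_y (\1_X (x : M) * mdist (x : M) y ^+ 2)%:E in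
  [/\ measurable_fun setT H, measurable_fun [set: borel M] (second_moment mu) &
    \int[mu]_x H x = \int[nu]_y second_moment mu y].
Proof.
move=> cX X0 muX H; have mX := compact_measurable_borel _ cX.
pose f (z : borel M * borel M) := (\1_X (z.1 : M) * mdist (z.1 : M) z.2 ^+ 2)%:E.
have mf : measurable_fun setT f.
  apply/measurable_EFinP; rewrite (_ : (fun z => _) =
      (fun z : borel M * borel M => (\1_X (z.1 : M) * mdist (z.1 : M) z.2) ^+ 2)%R).
    exact: measurable_funX (measurable_indic_mdist _ cX X0).
  by apply/funext => z; rewrite exprMn indicE; case: (_ \in _); rewrite ?expr1n ?expr0n.
have f0 z : 0 <= f z by rewrite lee_fin mulr_ge0// sqr_ge0.
have smE y : \int[mu]_x f (x, y) = second_moment mu y.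
  apply: (@ge0_ae_eq_integral _ _ _ mu setT) => //.
  - exact: measurableT_comp mf _.
  - exact: measurable_sqr_mdist.
  - by move=> x _; rewrite lee_fin sqr_ge0.
  apply: probability_full mX muX _ => x Xx _.
  by rewrite /f/= indicE mem_set// mul1r.
split.
- exact: (measurable_fun_fubini_tonelli_F (m2 := nu) f mf f0).
- have := measurable_fun_fubini_tonelli_G (m1 := mu) f mf f0.
  by congr measurable_fun; apply/funext.
- rewrite -(eq_integral _ _ (fun y _ => smE y)).
  exact: (fubini_tonelli (m1 := mu) (m2 := nu) f mf f0).
Qed.

Lemma second_moment_ge0 {R : realType} {M : pmetricType R}
    (mu : probability (borel M) R) (y : M) : 0 <= second_moment mu y.
Proof. by apply: integral_ge0 => x _; rewrite lee_fin sqr_ge0. Qed.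

Lemma Var_le {R : realType} {M : pmetricType R}
    (mu : probability (borel M) R) (y : M) : Var mu <= second_moment mu y.
Proof. by apply: ereal_inf_lbound; exists y. Qed.

(** Averaging [Var mu <= second_moment mu y] over [nu] and exchanging the integrals bounds the
    variance by the [mu]-mean of a function that is at most [v]. In case of equality, the
    nonnegative gap to [v] has zero integral, hence vanishes almost everywhere. *)
Lemma Var_le_max {R : realType} {M : pmetricType R} (X : set M)
    (mu nu : probability (borel M) R) (v : R) :
  compact X -> X !=set0 -> PX X mu -> (0 <= v)%R ->
  (forall x, X x -> \int[nu]_y (mdist x y ^+ 2)%:E <= v%:E) ->
  Var mu <= v%:E /\
  (Var mu = v%:E -> {ae mu, forall x, \int[nu]_y (mdist (x : M) y ^+ 2)%:E = v%:E}).
Proof.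
move=> cX X0 muX v0 nuv; have mX := compact_measurable_borel _ cX.
have [] := fubini_sqr_mdist _ _ nu cX X0 muX.
set H := fun x : borel M => _ => mH mS HS.
have HX x : X x -> H x = \int[nu]_y (mdist x y ^+ 2)%:E.
  by move=> Xx; apply: eq_integral => y _; rewrite indicE mem_set// mul1r.
have H0 x : 0 <= H x.
  by apply: integral_ge0 => y _; rewrite lee_fin mulr_ge0// sqr_ge0.
have Hv x : H x <= v%:E.
  have [Xx|nX] := pselect (X x); first by rewrite HX//; exact: nuv.
  rewrite /H integral0_eq// => y _; by rewrite indicE memNset// mul0r.
have VH : Var mu <= \int[mu]_x H x.
  rewrite HS -[leLHS](probability_integral_cst nu).
  apply: (@ge0_le_integral _ _ _ nu) => // y _; last exact: Var_le.
  by apply: le_ereal_inf_tmp => _ [z _ <-]; exact: second_moment_ge0.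
have Hle : \int[mu]_x H x <= v%:E.
  rewrite -[leRHS](probability_integral_cst mu).
  by apply: (@ge0_le_integral _ _ _ mu) => // y _; rewrite lee_fin.
split; first exact: le_trans VH Hle.
move=> Vv; have Hv' : \int[mu]_x H x = v%:E by apply/eqP; rewrite eq_le Hle -Vv VH.
pose g x := v%:E - H x.
have g0 x : 0 <= g x by rewrite sube_ge0 ?Hv ?orbT.
have mg : measurable_fun setT g by exact: emeasurable_funB.
have Ig : \int[mu]_x g x = 0.
  have : \int[mu]_x (H x + g x) = v%:E.
    rewrite -[RHS](probability_integral_cst mu); apply: eq_integral => x _.
    rewrite /g addeC subeK//.
    rewrite ge0_fin_numE//; exact: le_lt_trans (Hv x) (ltry _).
  rewrite ge0_integralD// Hv'.
  by case: (\int[mu]_x g x) => [r [vr]| |]//; congr EFin; lra.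
have : ae_eq mu setT g (cst 0).
  apply/(@ae_eq_integral_abs _ _ _ mu) => //.
  by rewrite -[RHS]Ig; apply: eq_integral => x _; rewrite gee0_abs.
have := probability_full mu X X mX muX (fun t h => h).
apply: (@filterS2 _ _ (ae_filter_ringOfSetsType mu)) => x Xx /(_ I)/= gx.
rewrite -HX//; apply/eqP; rewrite eq_le Hv/=.
by rewrite -sube_le0 -/(g x) gx.
Qed.

(** * Optimal strategies of the two players *)

Lemma compact_mdist_bounded {R : realType} {M : pmetricType R} (K : set M) (z : M) :
  compact K -> exists2 D : R, (0 <= D)%R & forall x, K x -> (mdist x z <= D)%R.
Proof.
move=> cK; have [K0|nK] := pselect (K !=set0); last first.
  by exists 0%R => // x Kx; exfalso; apply: nK; exists x.
have [q _ /(_ 1%R ltr01)[N qN]] := compact_net _ cK K0.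
exists (1 + \sum_(i < N) mdist (q i) z)%R => [|x /qN[i iN xi]].
  by rewrite addr_ge0// sumr_ge0// => i _; exact: mdist_ge0.
apply: le_trans (metric_triangle _ (q i) _) _; apply: lerD; first exact: ltW.
rewrite (bigD1 (Ordinal iN))//= lerDl sumr_ge0// => j _; exact: mdist_ge0.
Qed.

Lemma sqr_mdist_lipschitz {R : realType} {M : pmetricType R} (D : R) (x x' y : M) :
  (mdist x y <= D)%R -> (mdist x' y <= D)%R ->
  (`|mdist x y ^+ 2 - mdist x' y ^+ 2| <= 2 * D * mdist x x')%R.
Proof.
move=> xD x'D; rewrite subr_sqr normrM mulrC; apply: ler_pM => //.
  by rewrite ger0_norm ?addr_ge0 ?mdist_ge0//; lra.
exact: ler_mdist_dist.
Qed.

Lemma PX_discrete {R : realType} {M : pmetricType R} (K : set M)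
    (n : nat) (w : nat -> R) (x : nat -> M) :
  measurable (K : set (borel M)) -> (forall i, 0 <= w i)%R ->
  (\sum_(i < n) w i = 1)%R -> (forall i, K (x i)) ->
  exists2 P : probability (borel M) R, PX K P & forall f : M -> R,
    continuous f -> (forall t, 0 <= f t)%R ->
    \int[P]_t (f t)%:E = (\sum_(i < n) w i * f (x i))%:E.
Proof.
move=> mK w0 w1 Kx.
have [P PE] := discrete_probability n w (x : nat -> borel M) w0 w1.
exists P.
  rewrite /PX/= -[K]setIT -integral_indic//.
  rewrite PE//; last by apply/measurable_EFinP; exact: measurable_indic.
  rewrite -w1 -sumEFin; apply: eq_bigr => i _.
  by rewrite indicE mem_set// mule1.
move=> f cf f0; rewrite PE//; first by rewrite -sumEFin.
by apply/measurable_EFinP; exact: continuous_measurable_borel.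
Qed.

(** As an infimum of the functionals [second_moment ^~ y], the variance is upper semicontinuous for
    the convergence of [compact_PX], so a limit of a maximizing sequence is a maximizer. Boundedness
    of [X] makes the supremum finite. *)
Lemma max_Var {R : realType} {M : pmetricType R} (X : set M) :
  compact X -> X !=set0 -> exists (mu0 : probability (borel M) R) (v : R),
    [/\ PX X mu0, (0 <= v)%R, Var mu0 = v%:E &
      forall mu, PX X mu -> Var mu <= v%:E].
Proof.
move=> cX [x0 Xx0]; have mX := compact_measurable_borel _ cX.
have [D D0 XD] := compact_mdist_bounded _ x0 cX.
pose S := ereal_sup [set Var mu | mu in PX X].
have Sub mu : PX X mu -> Var mu <= S by move=> muX; apply: ereal_sup_ubound; exists mu.
have VD mu : PX X mu -> Var mu <= (D ^+ 2)%:E.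
  move=> muX; apply: le_trans (Var_le mu x0) _.
  rewrite -(add0e (D ^+ 2)%:E).
  have -> : 0 = \int[mu]_x (0%R : R)%:E by rewrite integral0.
  apply: (probability_integral_leD mu X) => //.
  - by apply: continuous_measurable_borel; exact: sqr_mdist_continuous.
  - by move=> x; exact: sqr_ge0.
  - exact: sqr_ge0.
  - by move=> x /XD xD; rewrite add0r lerXn2r// nnegrE mdist_ge0.
have V0 (mu : probability (borel M) R) : 0 <= Var mu.
  by apply: le_ereal_inf_tmp => _ [z _ <-]; exact: second_moment_ge0.
have [P PX0 _] : exists2 P : probability (borel M) R, PX X P & True.
  have [||||P PXP _] := PX_discrete X 1 (fun=> 1%R) (fun=> x0) => //.
    by rewrite big_ord1.
  by exists P.
have S0 : 0 <= S by apply: le_trans (V0 P) (Sub _ PX0).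
have Sfin : S \is a fin_num.
  rewrite ge0_fin_numE//; apply: le_lt_trans (ltry (D ^+ 2)).
  by apply: ge_ereal_sup => _ [mu muX <-]; exact: VD.
have [v vS] : exists v, S = v%:E by exists (fine S); rewrite fineK.
have /choice[mu_ muP] : forall n : nat, exists mu : probability (borel M) R,
    PX X mu /\ S - (n.+1%:R^-1)%:E < Var mu.
  move=> n; have [|_ [mu muX <-] Smu] :=
    @ub_ereal_sup_adherent R [set Var mu | mu in PX X] (n.+1%:R^-1)%R _ Sfin.
    by rewrite invr_gt0.
  by exists mu.
have [|mu0 mu0X mu0P] := compact_PX X mu_ cX (ex_intro _ x0 Xx0).
  by move=> n; have [] := muP n.
exists mu0, v; split => //; first by rewrite -lee_fin -vS.
  apply/eqP; rewrite eq_le -vS Sub//=.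
  apply: le_ereal_inf_tmp => _ [y _ <-].
  (* One half of [e] pays for the passage from [mu_ n] to [mu0], the other for the defect [1/(n+1)]
     of [mu_ n] from the supremum. *)
  apply/lee_addgt0Pr => e e0.
  have e20 : (0 < e / 2)%R by rewrite divr_gt0.
  have [Dy _ XDy] := compact_mdist_bounded _ y cX.
  have [||x x' Xx Xx'|n nN [_ h]] := mu0P (fun x => mdist x y ^+ 2)%R (2 * Dy)%R _ _ _
      (e / 2)%R (Num.truncn (e / 2)^-1) e20.
  - exact: sqr_mdist_continuous.
  - by move=> x; exact: sqr_ge0.
  - by apply: sqr_mdist_lipschitz; exact: XDy.
  have ne : (n.+1%:R^-1 < e / 2)%R.
    rewrite invf_plt ?posrE//; apply: lt_le_trans (truncnS_gt _) _.
    by rewrite ler_nat.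
  have [_ /ltW Smu] := muP n.
  have {h}Smu := le_trans Smu (le_trans (Var_le _ y) h).
  rewrite vS leeBlDr// in Smu.
  rewrite vS; apply: le_trans Smu _; rewrite -addeA -EFinD leeD2l// lee_fin.
  by move: ne; move: (n.+1%:R^-1)%R => z; lra.
by move=> mu muX; rewrite -vS; exact: Sub.
Qed.

(** [approachability] is played on a finite net of [X], with excesses [mdist (q i) y ^+ 2 - v]; the
    empirical measure of the answers is the desired [nu]. *)
Lemma near_optimal_nu {R : realType} {M : pmetricType R} (X : set M) (v e : R) :
  compact X -> X !=set0 ->
  (forall mu, PX X mu -> exists y : M, is_barycenter mu y) ->
  compact (bconv X) -> (0 < e)%R ->
  (forall mu : probability (borel M) R, PX X mu -> Var mu <= v%:E) ->
  exists2 nu, PX (bconv X) nu &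
    forall x, X x -> \int[nu]_y (mdist x y ^+ 2)%:E <= (v + e)%:E.
Proof.
move=> cX X0 bary cY e0 Vv.
have mX := compact_measurable_borel _ cX; have mY := compact_measurable_borel _ cY.
have [q Xq qnet] := compact_net _ cX X0.
have dist_cont x : continuous (fun y : M => mdist x y ^+ 2)%R.
  rewrite (_ : (fun y => _) = (fun y => mdist y x ^+ 2)%R).
    exact: sqr_mdist_continuous.
  by apply/funext => y; rewrite metric_sym.
have [D D0 XYD] : exists2 D : R, (0 <= D)%R &
    forall x y, X x -> bconv X y -> (mdist x y <= D)%R.
  have [D1 D10 XD1] := compact_mdist_bounded _ point cX.
  have [D2 D20 YD2] := compact_mdist_bounded _ point cY.
  exists (D1 + D2)%R => [|x y /XD1 xD /YD2 yD]; first exact: addr_ge0.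
  apply: le_trans (metric_triangle _ point _) _.
  by rewrite [X in (_ + X)%R]metric_sym lerD.
have resp n (w : nat -> R) : (forall i, 0 <= w i)%R -> exists2 y, bconv X y &
    (\sum_(i < n) w i * (mdist (q i) y ^+ 2 - v) <= 0)%R.
  move=> w0.
  pose W := (\sum_(i < n) w i)%R.
  have W0 : (0 <= W)%R by rewrite sumr_ge0.
  have PY (P : probability (borel M) R) : PX X P ->
      exists2 y, bconv X y & second_moment P y <= v%:E.
    move=> PXP; have [y yP] := bary _ PXP; exists y; first by exists P.
    by rewrite yP; exact: Vv.
  (* If all weights vanish there is nothing to normalize, and any point of the hull answers, for
     instance a barycenter of the point mass at [x0]. *)
  move: W0; rewrite le_eqVlt => /predU1P[W0|W0].
    have [x0 Xx0] := X0.
    have [||||P PXP _] := PX_discrete X 1 (fun=> 1%R) (fun=> x0) => //.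
      by rewrite big_ord1.
    have [y Yy _] := PY P PXP; exists y => //.
    rewrite big1// => i _; suff -> : w i = 0%R by rewrite mul0r.
    by move/esym/psumr_eq0P : W0; apply.
  have [||||P PXP PE] := PX_discrete X n (fun i => w i / W)%R q => //.
  - by move=> i; rewrite divr_ge0// ltW.
  - by rewrite -mulr_suml divff// lt0r_neq0.
  have [y Yy yv] := PY P PXP; exists y => //.
  move: yv; rewrite /second_moment (PE (fun x => mdist x y ^+ 2)%R); last 2 first.
  - exact: sqr_mdist_continuous.
  - by move=> x; exact: sqr_ge0.
  rewrite lee_fin (eq_bigr (fun i : 'I_n => (w i * mdist (q i) y ^+ 2) / W)%R); last first.
    by move=> i _; rewrite mulrAC.
  rewrite -mulr_suml ler_pdivrMr// => h.
  rewrite (eq_bigr (fun i : 'I_n => w i * mdist (q i) y ^+ 2 - w i * v)%R); last first.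
    by move=> i _; rewrite mulrBr.
  by rewrite sumrB -mulr_suml subr_le0 mulrC.
(* Replacing a point of [X] by a net point at distance less than [delta] changes the squared
   distances to the hull by at most [e / 2]; the 1 covers the case [D = 0]. Approachability uses the
   other half of [e]. *)
pose delta := (e / 2 / (2 * D + 1))%R.
have D1 : (0 < 2 * D + 1)%R by lra.
have [|n qn] := qnet delta; first by rewrite !divr_gt0.
have [||T [ys [T0 ysY ysv]]] := approachability (bconv X) n
    (fun i y => mdist (q i) y ^+ 2 - v)%R (D ^+ 2 + `|v|)%R _ (resp n) (e / 2)%R.
- move=> i y Yy; apply: le_trans (ler_normB _ _) _; rewrite lerD2r ger0_norm ?sqr_ge0//.
  by rewrite lerXn2r ?nnegrE ?mdist_ge0//; exact: XYD.
- by rewrite divr_gt0.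
have TR0 : (0 < T%:R :> R)%R by rewrite ltr0n.
have [||||nu nuY nuE] := PX_discrete (bconv X) T (fun=> T%:R^-1)%R ys => //.
  by rewrite sumr_const card_ord -[LHS]mulr_natr mulVf// lt0r_neq0.
exists nu => // x Xx.
rewrite (nuE (fun y => mdist x y ^+ 2)%R) => [|//|y]; last exact: sqr_ge0.
have [i ilt xi] := qn x Xx.
rewrite lee_fin -mulr_sumr mulrC ler_pdivrMr//.
apply: (@le_trans _ _ (\sum_(t < T) ((mdist (q i) (ys t) ^+ 2 - v) + (v + e / 2)))%R).
  apply: ler_sum => t _.
  have := sqr_mdist_lipschitz D x (q i) (ys t)
    (XYD _ _ Xx (ysY t)) (XYD _ _ (Xq i) (ysY t)).
  have : (2 * D * mdist x (q i) <= e / 2)%R.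
    rewrite ltr_pdivlMr// in xi; apply: le_trans (ltW xi).
    by rewrite mulrC ler_wpM2l ?mdist_ge0//; lra.
  by rewrite ler_norml; lra.
rewrite big_split/= sumr_const card_ord -[X in (_ + X <= _)%R]mulr_natr.
by have := ysv i ilt; nra.
Qed.

(** A limit in the compact hull of near-optimal measures with errors [1/(n+1)]; the cost at each
    fixed [x] passes to the limit. *)
Lemma optimal_nu {R : realType} {M : pmetricType R} (X : set M) (v : R) :
  compact X -> X !=set0 ->
  (forall mu, PX X mu -> exists y : M, is_barycenter mu y) ->
  compact (bconv X) ->
  (forall mu : probability (borel M) R, PX X mu -> Var mu <= v%:E) ->
  exists2 nu, PX (bconv X) nu &
    forall x, X x -> \int[nu]_y (mdist x y ^+ 2)%:E <= v%:E.
Proof.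
move=> cX X0 bary cY Vv.
have /choice[nu_ nuP] : forall n : nat, exists nu, PX (bconv X) nu /\
    forall x, X x -> \int[nu]_y (mdist x y ^+ 2)%:E <= (v + n.+1%:R^-1)%:E.
  move=> n; have [|nu nuY nux] := near_optimal_nu X v n.+1%:R^-1%R cX X0 bary cY _ Vv.
    by rewrite invr_gt0.
  by exists nu.
have nuY n : PX (bconv X) (nu_ n) by have [] := nuP n.
have Y0 : bconv X !=set0.
  apply: contrapT => nY; have := nuY 0%N; rewrite /PX/= (_ : bconv X = set0).
    by rewrite measure0 => /eqP; rewrite eq_sym onee_eq0.
  by apply/seteqP; split=> // y Yy; apply: nY; exists y.
have [nu nu0Y nulim] := compact_PX (bconv X) nu_ cY Y0 nuY.
exists nu => // x Xx; apply/lee_addgt0Pr => e e0.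
have e20 : (0 < e / 2)%R by rewrite divr_gt0.
have [D _ YD] := compact_mdist_bounded _ x cY.
have dsym : (fun y => mdist x y ^+ 2)%R = (fun y => mdist y x ^+ 2)%R.
  by apply/funext => y; rewrite metric_sym.
have [||y y' Yy Yy'|n nN [h _]] := nulim (fun y => mdist x y ^+ 2)%R (2 * D)%R _ _ _
    (e / 2)%R (Num.truncn (e / 2)^-1) e20.
- by rewrite dsym; exact: sqr_mdist_continuous.
- by move=> y; exact: sqr_ge0.
- rewrite (metric_sym x y) (metric_sym x y'); apply: sqr_mdist_lipschitz; exact: YD.
have ne : (n.+1%:R^-1 < e / 2)%R.
  rewrite invf_plt ?posrE//; apply: lt_le_trans (truncnS_gt _) _.
  by rewrite ler_nat.
apply: le_trans h _; have [_ /(_ x Xx) nux] := nuP n.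
apply: le_trans (leeD2r _ nux) _; rewrite -!EFinD lee_fin.
by move: ne; move: (n.+1%:R^-1)%R => z; lra.
Qed.

(** * The common value and the circumcenters *)

Theorem theorem3p1 (R : realType) (M : pmetricType R) (X : set M) :
  complete_metric (M := M) ->
  compact X -> X !=set0 ->
  (forall mu, PX X mu -> exists y : M, is_barycenter mu y) ->
  compact (bconv X) ->
  exists nu : probability (borel M) R,
    is_circumcenter X nu /\
    (exists mu0, PX X mu0 /\ (forall mu, PX X mu -> Var mu <= Var mu0) /\
       circumradius X * circumradius X = Var mu0) /\
    (exists nu0, PX (bconv X) nu0 /\
       (forall nu1, PX (bconv X) nu1 -> AVar X nu0 <= AVar X nu1) /\
       circumradius X * circumradius X = AVar X nu0) /\
    (forall mub, PX X mub -> (forall mu, PX X mu -> Var mu <= Var mub) ->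
       {ae mub, forall x, W2_dirac x nu = circumradius X} /\
       (forall nub, is_circumcenter X nub ->
          {ae mub, forall x, W2_dirac x nub = circumradius X})).
Proof.
move=> _ cX X0 bary cY.
have [mu0 [v [mu0X v0 Vmu0 Vv]]] := max_Var X cX X0.
have [nu0 nu0Y nu0v] := optimal_nu X v cX X0 bary cY Vv.
have I0 x (nu : probability (borel M) R) : 0 <= \int[nu]_y (mdist x y ^+ 2)%:E.
  by apply: integral_ge0 => y _; rewrite lee_fin sqr_ge0.
have v0e : 0 <= v%:E by rewrite lee_fin.
have [x0 Xx0] := X0.
(* Weak duality against the maximizer [mu0]. It constrains every [nu] on [M], not only those carried
   by the hull, and so bounds the circumradius from below. *)
have dual (nu : probability (borel M) R) (w : \bar R) :
    (forall x, X x -> \int[nu]_y (mdist x y ^+ 2)%:E <= w) -> v%:E <= w.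
  move=> nuw; have w0 : 0 <= w := le_trans (I0 x0 nu) (nuw _ Xx0).
  case: w w0 nuw => [w| |]; [|by move=> *; exact: leey|by rewrite leNgt ltNy0].
  rewrite lee_fin => w0 nuw; rewrite -Vmu0.
  by have [] := Var_le_max X mu0 nu w cX X0 mu0X w0 nuw.
have AVar_ge nu : v%:E <= AVar X nu.
  by apply: (dual nu) => x Xx; apply: ereal_sup_ubound; exists x.
have AVar_nu0 : AVar X nu0 = v%:E.
  apply/eqP; rewrite eq_le AVar_ge andbT.
  by apply: ge_ereal_sup => _ [x Xx <-]; exact: nu0v.
have far_ge nu : sqrte v%:E <= farthest X nu.
  have far0 : 0 <= farthest X nu.
    have le : W2_dirac x0 nu <= farthest X nu by apply: ereal_sup_ubound; exists x0.
    exact: le_trans (sqrte_ge0 _) le.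
  rewrite -[leRHS]gee0_abs// -sqrte_sqr lee_sqrt ?sqre_ge0//.
  apply: (dual nu) => x Xx; rewrite -(sqr_sqrte (I0 x nu)) !expe2.
  have le : sqrte (\int[nu]_y (mdist x y ^+ 2)%:E) <= farthest X nu.
    by apply: ereal_sup_ubound; exists x.
  by apply: lee_pmul => //; exact: sqrte_ge0.
have far_nu0 : farthest X nu0 = sqrte v%:E.
  apply/eqP; rewrite eq_le far_ge andbT.
  by apply: ge_ereal_sup => _ [x Xx <-]; rewrite lee_sqrt//; exact: nu0v.
have cr : circumradius X = sqrte v%:E.
  apply/eqP; rewrite eq_le; apply/andP; split.
    by rewrite -far_nu0; apply: ereal_inf_lbound; exists nu0.
  by apply: le_ereal_inf_tmp => _ [nu _ <-]; exact: far_ge.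
have cr2 : circumradius X * circumradius X = v%:E.
  by rewrite cr -expe2 sqr_sqrte.
have ae_cr (mub nu : probability (borel M) R) : PX X mub ->
    (forall mu, PX X mu -> Var mu <= Var mub) -> is_circumcenter X nu ->
    {ae mub, forall x, W2_dirac (x : M) nu = circumradius X}.
  move=> mubX mubmax nuc.
  have Vmub : Var mub = v%:E.
    by apply/eqP; rewrite eq_le Vv//= -Vmu0 mubmax.
  (* No point of [i(X)] is farther than the circumradius from a circumcenter, so every circumcenter
     satisfies the hypothesis of the equality case in [Var_le_max]. *)
  have nuv x : X x -> \int[nu]_y (mdist x y ^+ 2)%:E <= v%:E.
    move=> Xx; rewrite -lee_sqrt// -cr -nuc.
    by apply: ereal_sup_ubound; exists x.
  have [_ /(_ Vmub)] := Var_le_max X mub nu v cX X0 mubX v0 nuv.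
  apply: (@filterS _ _ (ae_filter_ringOfSetsType mub)) => x xv.
  by rewrite /W2_dirac xv cr.
have nu0c : is_circumcenter X nu0 by rewrite /is_circumcenter far_nu0.
exists nu0; split => //; split; [|split].
- by exists mu0; split => //; split; [rewrite Vmu0|rewrite cr2].
- by exists nu0; split => //; split; [rewrite AVar_nu0|rewrite cr2].
- by move=> mub mubX mubmax; split; [|move=> nub nubc]; exact: ae_cr.
Qed.
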